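(* Let $T\in \boldsymbol B(\mathcal H)$ be a CPD operator with the representing triplet $(B,C,F)$ such that $\operatorname{supp} F \subseteq [0,1]$. Suppose that $T$ is similar to a subnormal operator. Then the following conditions hold: (i) $C = 0$, (ii) $B+F(\mathbb R_+)\leqslant 0$, (iii) $B+F(\mathbb R_+) = 0$ or $\operatorname{supp} F \not\subseteq \{0\}$, (iv) $B\not\geqslant 0$ or $\operatorname{supp} F \cap (0,1) = \emptyset$.
   Context: Hilbert spaces are complex; $\mathbb R_+=[0,\infty)$, $\mathbb Z_+=\{0,1,2,\dots\}$. An operator $T\in\boldsymbol B(\mathcal H)$ (bounded linear operators on $\mathcal H$) is conditionally positive definite (CPD) if for every $h\in\mathcal H$ the sequence $\gamma_n=\|T^nh\|^2$ satisfies $\sum_{i,j=0}^k\gamma_{i+j}\alpha_i\bar\alpha_j\geqslant0$ for all finite complex sequences $\alpha_0,\dots,\alpha_k$ with $\sum_{j=0}^k\alpha_j=0$. Let $Q_0=Q_1=0$ and $Q_n(x)=\sum_{j=0}^{n-2}(n-j-1)x^j$ for $n\geqslant2$. A semispectral measure $F$ on the Borel subsets of $\mathbb R_+$ is a $\boldsymbol B(\mathcal H)$-valued map, $\sigma$-additive in the weak operator topology, with $F(\Delta)\geqslant0$ for all Borel $\Delta$ (it is not assumed that $F(\mathbb R_+)=I$); $\operatorname{supp}F$ is its closed support. It is known that $T$ is CPD if and only if there exist $B,C\in\boldsymbol B(\mathcal H)$ and a compactly supported semispectral measure $F$ on the Borel subsets of $\mathbb R_+$ such that $B=B^*$, $C\geqslant0$,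 $F(\{1\})=0$ and $$T^{*n}T^n=I+nB+n^2C+\int_{\mathbb R_+}Q_n(x)\,F(\mathrm dx),\quad n\in\mathbb Z_+;$$ the triplet $(B,C,F)$ is then unique and is called the representing triplet of $T$. Operators $A\in\boldsymbol B(\mathcal H)$ and $S\in\boldsymbol B(\mathcal K)$ are similar if $XA=SX$ for some bijective $X\in\boldsymbol B(\mathcal H,\mathcal K)$. *)

(* Defs.v *)
From HB Require Import structures.
From mathcomp Require Import all_boot all_order all_algebra.
From mathcomp Require Import all_classical all_reals all_analysis.
From mathcomp.real_closed Require Import complex.

Set Implicit Arguments.
Unset Strict Implicit.
Unset Printing Implicit Defensive.
Import Order.TTheory GRing.Theory Num.Theory.
Import numFieldNormedType.Exports.

Local Open Scope classical_set_scope.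
Local Open Scope ring_scope.

(* The type annotation lets the topological instances of an abstract
   [numFieldType] apply to the concrete type [complex R]. *)
Local Notation Cx R := (complex R : numFieldType).

(* The inner product is linear in its first argument and antilinear in the
   second one, as for every form of type [{dot _ for _}]. *)
HB.mixin Record CompleteNormedModule_isHilbert (R : realType) (H : Type)
    & CompleteNormedModule (complex R) H := {
  inner : {dot H for (@Num.conj (complex R))} ;
  inner_norm : forall x : H, `|x| ^+ 2 = inner x x }.

#[short(type="hilbertType")]
HB.structure Definition Hilbert (R : realType) :=
  { H of CompleteNormedModule (complex R) H
       & CompleteNormedModule_isHilbert R H }.

Notation "''[' u , v ]" := (inner u%R v%R) : ring_scope.

HB.mixin Record isBoundedOp (R : realType) (H K : hilbertType R) (f : H -> K) := {
  bounded_op : exists M : R[i], forall x, `|f x| <= M * `|x| }.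

HB.structure Definition BoundedOp (R : realType) (H K : hilbertType R) :=
  { f of @GRing.Linear (complex R) H K *:%R f & isBoundedOp R H K f }.

Notation "{ 'bounded' H -> K }" := (BoundedOp.type H%type K%type)
  (at level 0, H at level 98, K at level 99,
   format "{ 'bounded'  H  ->  K }") : type_scope.

Section operators.
Variable R : realType.
Implicit Types H K : hilbertType R.

(* On [R[i]], [a <= b] means that [b - a] is a nonnegative real. *)
Definition op_le H (A B : H -> H) := forall h, '[A h, h] <= '[B h, h].

(* [A' = A^*]; such an [A'] exists and is unique by the Riesz theorem. *)
Definition adjoint_of H (A A' : {bounded H -> H}) :=
  forall x y, '[A x, y] = '[x, A' y].

Definition self_adjoint H (A : {bounded H -> H}) := adjoint_of A A.

Definition normal_op H (N : {bounded H -> H}) :=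
  exists N' : {bounded H -> H}, adjoint_of N N' /\ N' \o N =1 N \o N'.

(* [H] is identified with its image in [K] under the linear isometry [V]. *)
Definition subnormal_op H (S : {bounded H -> H}) :=
  exists (K : hilbertType R) (V : {bounded H -> K}) (N : {bounded K -> K}),
    [/\ forall h, `|V h| = `|h|, normal_op N & N \o V =1 V \o S].

Definition similar_op H K (A : {bounded H -> H}) (S : {bounded K -> K}) :=
  exists2 X : {bounded H -> K}, bijective X & X \o A =1 S \o X.

Definition cond_pos_def H (T : {bounded H -> H}) :=
  forall (h : H) (k : nat) (a : 'I_k.+1 -> R[i]),
    \sum_(j < k.+1) a j = 0 ->
    0 <= \sum_(i < k.+1) \sum_(j < k.+1)
           `|iter (i + j)%N T h| ^+ 2 * a i * (a j)^*.

End operators.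

Definition Rplus (R : realType) : set R := `[0, +oo[.
Arguments Rplus : clear implicits.

(* Only the values of [sm_val] at Borel subsets of [Rplus] are meaningful.
   The sums in [sm_sigma_additive] converge in [R[i]] for each fixed pair of
   vectors, which is convergence in the weak operator topology. *)
Record semispectral (R : realType) (H : hilbertType R) := Semispectral {
  sm_val :> set R -> {bounded H -> H} ;
  sm_ge0 : forall D, measurable D -> D `<=` Rplus R -> op_le \0 (sm_val D) ;
  sm_sigma_additive : forall D : (set R)^nat,
    (forall n, measurable (D n)) -> (forall n, D n `<=` Rplus R) ->
    trivIset setT D -> forall g h : H,
    (fun n => \sum_(0 <= i < n) '[sm_val (D i) g, h] : Cx R) @ \oo -->
      ('[sm_val (\bigcup_n D n) g, h] : Cx R) }.

Section semispectral.
Variables (R : realType) (H : hilbertType R).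
Implicit Types (F : semispectral H) (T B C A : {bounded H -> H}).

Lemma measurable_Rplus : measurable (Rplus R).
Proof. exact: measurable_itv. Qed.

(* The closed support: the complement in [Rplus] of the union of the relatively
   open sets on which [F] vanishes. *)
Definition sm_supp F : set R :=
  [set x | Rplus R x /\
     forall U, open U -> U x -> ~ F (U `&` Rplus R) =1 \0].

(* The measure <F(.)h, h>, carried by [Rplus]; the library requires measures
   to be nonnegative on non-measurable sets too, hence the case distinction. *)
Definition sm_measure F (h : H) (D : set R) : \bar R :=
  if `[< measurable D >] then (complex.Re '[F (D `&` Rplus R) h, h])%:E else 0%E.

Lemma complex_Re_ge0 (z : R[i]) : 0 <= z -> 0 <= complex.Re z.
Proof. by rewrite lecE => /andP[]. Qed.

Lemma cvg_complex_Re (u : nat -> R[i]) (l : R[i]) :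
  ((u : nat -> Cx R) @ \oo --> (l : Cx R)) ->
  (fun n => complex.Re (u n)) @ \oo --> complex.Re l.
Proof.
move=> ul; apply/cvgrPdist_lt => e e0.
have e0' : 0 < (e%:C)%C :> Cx R by rewrite (ltcR 0 e).
move/cvgrPdist_lt : ul => /(_ _ e0'); apply: filterS => n.
rewrite -ltcR; apply: le_lt_trans.
case: (l) => a b; case: (u n) => c d; rewrite normc_def /= lecR.
by rewrite -sqrtr_sqr ler_wsqrtr// lerDl sqr_ge0.
Qed.

Lemma sm_set0 F g h : '[F set0 g, h] = 0.
Proof.
have tI : trivIset setT (fun _ : nat => set0 : set R) by exact: trivIset_set0.
have := @sm_sigma_additive _ _ F (fun=> set0) (fun=> measurable0)
  (fun=> @sub0set _ _) tI g h.
rewrite bigcup_const//; set a := '[_, _].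
move=> /cvgP /(@cvg_series_cvg_0 _ (Cx R)^o (fun=> a)) a0.
apply: (cvg_unique (@norm_hausdorff _ (Cx R)^o) _ a0).
exact: cvg_cst.
Qed.

Lemma sm_measure0 F h : sm_measure F h set0 = 0%E.
Proof. by rewrite /sm_measure set0I sm_set0; case: ifP. Qed.

Lemma sm_measure_ge0 F h D : (0 <= sm_measure F h D)%E.
Proof.
rewrite /sm_measure; case: ifPn => // /asboolP mD; rewrite lee_fin complex_Re_ge0//.
have /(_ h) := @sm_ge0 _ _ F _ (measurableI _ _ mD measurable_Rplus)
  (@subIsetr _ _ _).
by rewrite linear0l.
Qed.

Lemma sm_measure_sigma_additive F h : semi_sigma_additive (sm_measure F h).
Proof.
move=> D mD tD mUD.
have E n : (\sum_(0 <= i < n) sm_measure F h (D i))%E =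
    (complex.Re (\sum_(0 <= i < n) '[F (D i `&` Rplus R) h, h]))%:E.
  rewrite raddf_sum -sumEFin; apply: eq_bigr => i _.
  by rewrite /sm_measure asboolT.
under eq_fun do rewrite E.
rewrite /sm_measure asboolT// setI_bigcupl.
apply: cvg_EFin; first exact: nearW.
apply: (@cvg_complex_Re (fun n => \sum_(0 <= i < n) '[F (D i `&` Rplus R) h, h])).
apply: (@sm_sigma_additive _ _ F (fun n => D n `&` Rplus R)).
- by move=> n; apply: measurableI => //; exact: measurable_Rplus.
- by move=> n; exact: subIsetr.
- exact: trivIset_setIr.
Qed.

HB.instance Definition _ F h := isMeasure.Build _ _ _ (sm_measure F h)
  (sm_measure0 F h) (sm_measure_ge0 F h) (@sm_measure_sigma_additive F h).

(* [A] is the integral of [f] with respect to [F], in the weak sense. *)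
Definition sm_integral_op F (f : R -> R) A :=
  forall h, (sm_measure F h).-integrable (Rplus R) (EFin \o f) /\
    '[A h, h] = (\int[sm_measure F h]_(x in Rplus R) f x)%:C%C.

Definition Qpoly (n : nat) (x : R) : R :=
  \sum_(0 <= j < n.-1) (n - j - 1)%N%:R * x ^+ j.

(* [T'] is the adjoint of [T] and [J] the integral of [Qpoly n]; both are
   determined by the conditions imposed on them. *)
Definition representing_triplet T B C F :=
  [/\ self_adjoint B, op_le \0 C, F [set 1] =1 \0, compact (sm_supp F) &
   exists2 T' : {bounded H -> H}, adjoint_of T T' &
   forall n, exists2 J : {bounded H -> H}, sm_integral_op F (Qpoly n) J &
     forall h, iter n T' (iter n T h) =
       h + n%:R *: B h + (n ^ 2)%N%:R *: C h + J h].

End semispectral.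

(* Main.v *)
Require Import Defs.
From mathcomp Require Import all_boot all_order all_algebra.
From mathcomp Require Import all_classical all_reals all_analysis.
From mathcomp.real_closed Require Import complex.
From mathcomp Require Import measurable_realfun ring lra zify.

Set Implicit Arguments.
Unset Strict Implicit.
Unset Printing Implicit Defensive.
Import Order.TTheory GRing.Theory Num.Theory.
Import numFieldNormedType.Exports.

Local Open Scope classical_set_scope.
Local Open Scope ring_scope.

(** Everything follows from the scalar formula
    [|T^n h|^2 = |h|^2 + n <Bh,h> + n^2 <Ch,h> + int Q_n dF_h]
    ([orbit_sqr_norm]), where [F_h = <F(.)h,h>], once it is known that the
    orbits of [T] are bounded.

    Boundedness.  As [F] is carried by [[0,1]] and [Q_n <= n^2] there, the
    formula shows that [|T^n h|] grows at most linearly in [n]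
    ([orbit_linear_growth]).  If [X T = S X] with [S] subnormal, then the
    sequence [|S^n X h| = |X T^n h|] also grows at most linearly; but it is
    logarithmically convex, because [|N^(n+1) f|^2 <= |N^n f| |N^(n+2) f| ]
    for a normal [N], and a logarithmically convex sequence which increases
    at one step increases geometrically ever after.  Hence it never exceeds
    its first term.  By the open mapping theorem [X] is bounded below, so
    [|T^n h|] is bounded ([similar_subnormal_bounded_orbit]).  The open
    mapping theorem results from Baire's argument, which makes the image of
    some ball dense in a ball ([baire_somewhere_dense]), and from successive
    approximation ([approx_open_mapping]).

    Conclusions.  Since [Q_n >= 0], boundedness of
    [n <Bh,h> + n^2 <Ch,h>] from above forces [<Ch,h> <= 0], whence [C = 0]
    by polarization.  Since [Q_(n+1) - Q_n >= 1] for [n >= 1], the quantity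
    [n (<Bh,h> + F_h(R_+))] is bounded above, so [B + F(R_+) <= 0].  If [F]
    is carried by [{0}], then [Q_n(0) <= n] and the nonnegativity of
    [|T^n h|^2] give the opposite inequality [B + F(R_+) >= 0].  Finally, if
    [B >= 0], then [0 <= F(R_+) <= - B <= 0], so [F] vanishes and its support
    is empty. *)

(** * The norm of a Hilbert space as a real number *)

Section real_norm.
Variables (R : realType) (H : hilbertType R).
Implicit Types (x y z : H) (a : R).

(** The norm takes values in [R[i]], whose order is not total; its real part
    loses no information and allows reasoning in the ordered field [R]. *)
Definition rnorm x : R := complex.Re `|x|.

Lemma rnormE x : `|x| = (rnorm x)%:C%C.
Proof. by rewrite /rnorm RRe_real// normr_real. Qed.

Lemma rnorm_ge0 x : 0 <= rnorm x.
Proof. exact/complex_Re_ge0/normr_ge0. Qed.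

Lemma rnormD x y : rnorm (x + y) <= rnorm x + rnorm y.
Proof. by rewrite -lecR rmorphD /= -!rnormE ler_normD. Qed.

Lemma rnormN x : rnorm (- x) = rnorm x.
Proof. by rewrite /rnorm normrN. Qed.

Lemma rnormBC x y : rnorm (x - y) = rnorm (y - x).
Proof. by rewrite /rnorm distrC. Qed.

Lemma rnorm0 : rnorm 0 = 0.
Proof. by rewrite /rnorm normr0. Qed.

Lemma rnormZ a x : rnorm (a%:C%C *: x) = `|a| * rnorm x.
Proof.
apply: complexI; rewrite rmorphM /= -!rnormE normrZ; congr (_ * _).
by rewrite normc_def /= expr0n addr0 sqrtr_sqr.
Qed.

Lemma rnorm_eq0 x : rnorm x = 0 -> x = 0.
Proof. by move=> x0; apply/eqP; rewrite -normr_eq0 rnormE x0. Qed.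

Lemma rnormB x y z : rnorm (x - z) <= rnorm (x - y) + rnorm (y - z).
Proof. by rewrite -(subrKA y) rnormD. Qed.

Lemma inner_rnorm x : '[x, x] = (rnorm x ^+ 2)%:C%C.
Proof. by rewrite rmorphXn /= -rnormE -inner_norm. Qed.

Lemma inner_conj x y : '[x, y] = ('[y, x])^*.
Proof. by rewrite hermC /= expr0 mul1r. Qed.

Lemma Re_inner_conj x y : complex.Re '[x, y] = complex.Re '[y, x].
Proof. by rewrite inner_conj; case: '[y, x]. Qed.


Lemma rnormB_sqr a x y : rnorm (x - a%:C%C *: y) ^+ 2 =
  rnorm x ^+ 2 - 2 * a * complex.Re '[x, y] + a ^+ 2 * rnorm y ^+ 2.
Proof.
have <- : complex.Re '[x - a%:C%C *: y, x - a%:C%C *: y] =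
          rnorm (x - a%:C%C *: y) ^+ 2 by rewrite inner_rnorm.
set r := RHS.
rewrite linearBl/= !linearBr/= !linearZl_LR/= !linearZr_LR/= (inner_conj y x).
rewrite !inner_rnorm.
by rewrite /r; case: '[x, y] => p q /=; ring.
Qed.

(** Cauchy-Schwarz inequality: it expresses that [|x - t y|^2 >= 0] for
    [t = |x| / |y|]. *)
Lemma Re_inner_le x y : complex.Re '[x, y] <= rnorm x * rnorm y.
Proof.
have [/rnorm_eq0 ->|x0] := eqVneq (rnorm x) 0.
  by rewrite linear0l /= rnorm0 mul0r.
have [/rnorm_eq0 ->|y0] := eqVneq (rnorm y) 0.
  by rewrite linear0r /= rnorm0 mulr0.
have := sqr_ge0 (rnorm (x - (rnorm x / rnorm y)%:C%C *: y)).
rewrite rnormB_sqr.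
set a := rnorm x in x0 *; set b := rnorm y in y0 *; set p := complex.Re _.
have a_gt0 : 0 < a by rewrite lt_neqAle eq_sym x0 rnorm_ge0.
have b_gt0 : 0 < b by rewrite lt_neqAle eq_sym y0 rnorm_ge0.
have -> : a ^+ 2 - 2 * (a / b) * p + (a / b) ^+ 2 * b ^+ 2 =
  2 * (a / b) * (a * b - p) by field.
by rewrite pmulr_rge0 ?subr_ge0// mulr_gt0// divr_gt0.
Qed.

Lemma geometric_small c (e : R) : 0 < e -> exists n, c / 2 ^+ n < e.
Proof.
move=> e0; exists (Num.truncn (c / e)).
rewrite ltr_pdivrMr ?exprn_gt0// mulrC -ltr_pdivrMr//.
apply: (lt_le_trans (truncnS_gt _)).
by rewrite -natrX ler_nat ltn_expl.
Qed.

(** Completeness, with a bound for the distance to the limit: if the steps are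
    dominated by a sequence that is at least halved each time, then the tail
    after [n] has length at most [r n + r n / 2 + ... = 2 r n]. *)
Lemma cvg_halving (u : nat -> H) (r : nat -> R) :
  (forall n, rnorm (u n.+1 - u n) <= r n) -> (forall n, r n.+1 <= r n / 2) ->
  exists l, forall n, rnorm (u n - l) <= 2 * r n.
Proof.
move=> ur r2.
have r_ge0 n : 0 <= r n by apply: le_trans (ur n); exact: rnorm_ge0.
have r_geo n : r n <= r 0%N / 2 ^+ n.
  elim: n => [|n IH]; first by rewrite expr0 divr1.
  by rewrite exprSr invfM mulrA; have := r2 n; lra.
have tail n k : rnorm (u (n + k)%N - u n) <= 2 * r n.
  suff : rnorm (u (n + k)%N - u n) <= 2 * r n - 2 * r (n + k)%N.
    by have := r_ge0 (n + k)%N; lra.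
  elim: k => [|k IH]; first by rewrite addn0 !subrr rnorm0.
  apply: (le_trans (rnormB _ (u (n + k)%N) _)).
  by have := ur (n + k)%N; have := r2 (n + k)%N; rewrite -addnS; lra.
have /cvg_ex[l ul] : cvg (u @ \oo).
  apply: cauchy_cvg; apply: cauchy_exP => e; case: e => e ei.
  rewrite ltcE /= => /andP[/eqP -> e0].
  have [n ne] := geometric_small (2 * r 0%N) e0.
  exists (u n), n => // m /= /subnKC <-.
  rewrite -ball_normE /ball_ /= -opprB normrN rnormE ltcR.
  apply: le_lt_trans (tail n _) (le_lt_trans _ ne).
  by rewrite -mulrA ler_pM2l.
exists l => n; apply/ler_addgt0Pr => e e0.
have e0' : 0 < (e%:C)%C :> (R[i] : numFieldType) by rewrite (ltcR 0 e).
move/cvgrPdist_lt : ul => /(_ _ e0') [N _ /(_ (n + N)%N)] /=.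
rewrite leq_addl => /(_ isT); rewrite rnormE ltcR => lN.
apply: (le_trans (rnormB _ (u (n + N)%N) _)).
by rewrite lerD ?(rnormBC (u n)) ?tail// rnormBC ltW.
Qed.

(** * Open mapping theorem *)

(** Otherwise one can choose successively centers [s n] and radii so that the
    [n]-th choice escapes [A n] by more than the total length of all the
    later steps; the limit then belongs to no [A n]. *)
Lemma baire_somewhere_dense (A : nat -> set H) :
  (forall y, exists n, A n y) ->
  exists n y (r : R), 0 < r /\ forall z, rnorm (z - y) < r ->
    forall e, 0 < e -> exists2 w, A n w & rnorm (w - z) < e.
Proof.
move=> Acover; apply: contrapT => ndense.
have escape (s : nat * (H * R)) : exists t : H * R, 0 < s.2.2 ->
    [/\ 0 < t.2, rnorm (t.1 - s.2.1) <= s.2.2, t.2 <= s.2.2 / 2 &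
      forall w, A s.1 w -> 2 * t.2 < rnorm (t.1 - w)].
  case: s => n [y r] /=.
  have [r0|r0] := ltP 0 r; last by exists (y, r) => /=; rewrite ltNge r0.
  apply: contrapT => H0; apply: ndense; exists n, y, r; split => // z zr e e0.
  apply: contrapT => H1; apply: H0.
  (* One third of the gap [e]: the limit stays within twice the new radius
     of the new center, hence at a positive distance from [A n]. *)
  exists (z, Num.min (e / 3) (r / 2)) => /= _; split.
  - by rewrite lt_min !divr_gt0.
  - exact: ltW.
  - by rewrite ge_min lexx orbT.
  - move=> w Aw; rewrite ltNge; apply/negP => wz; apply: H1; exists w => //.
    rewrite rnormBC (le_lt_trans wz)//.
    have : Num.min (e / 3) (r / 2) <= e / 3 by rewrite ge_min lexx.
    lra.
have [f fP] := choice escape.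
pose s := fix s n : H * R := if n is m.+1 then f (m, s m) else (0, 1).
have s0 n : 0 < (s n).2.
  by elim: n => [|n IH] /=; [exact: ltr01|case: (fP (n, s n) IH)].
have [l lP] : exists l, forall n, rnorm ((s n).1 - l) <= 2 * (s n).2.
  by apply: (@cvg_halving (fun n => (s n).1) (fun n => (s n).2)) => n /=;
     case: (fP (n, s n) (s0 n)).
have [n Al] := Acover l.
case: (fP (n, s n) (s0 n)) => _ _ _ /(_ _ Al) /=.
by rewrite ltNge => /negP; apply; exact: (lP n.+1).
Qed.

End real_norm.

Section operator_bounds.
Variable R : realType.

Lemma bounded_rnorm (H K : hilbertType R) (X : {bounded H -> K}) :
  exists2 M : R, 0 <= M & forall x, rnorm (X x) <= M * rnorm x.
Proof.
have [M XM] := @bounded_op _ _ _ X.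
exists (`|complex.Re M|) => // x.
have := XM x; rewrite !rnormE; case: M {XM} => a b.
rewrite lecE /= => /andP[_] /le_trans; apply.
by rewrite mulr0 subr0 ler_wpM2r ?rnorm_ge0 ?ler_norm.
Qed.

(** The residues [k - X (s n)] are halved at each step, so the corrections added
    to [s n] form a convergent series, whose sum is mapped to [k]. *)
Lemma approx_open_mapping (H K : hilbertType R) (X : {bounded H -> K}) c :
  (forall k, exists2 h, rnorm h <= c * rnorm k & rnorm (k - X h) <= rnorm k / 2) ->
  forall k, exists2 h, X h = k & rnorm h <= 2 * (c * rnorm k).
Proof.
move=> approx k.
have [g g_le g_half] : exists2 g : K -> H,
    forall k, rnorm (g k) <= c * rnorm k & forall k, rnorm (k - X (g k)) <= rnorm k / 2.
  have /choice[g gP] : forall k, exists h,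
      rnorm h <= c * rnorm k /\ rnorm (k - X h) <= rnorm k / 2.
    by move=> k'; have [h] := approx k'; exists h.
  by exists g => k'; case: (gP k').
pose s := fix s n : H := if n is m.+1 then s m + g (k - X (s m)) else 0.
pose rest n := rnorm (k - X (s n)).
have restS n : rest n.+1 <= rest n / 2.
  by rewrite /rest /= linearD opprD addrA g_half.
have c_rest n : rnorm (s n.+1 - s n) <= c * rest n.
  by rewrite /= addrC addKr g_le.
(* A negative constant is possible only if [K] is trivial. *)
have [c0|c0] := ltP c 0.
  have rest0 n : rest n = 0.
    apply/eqP; rewrite eq_le rnorm_ge0 andbT -(ler_nM2l c0) mulr0.
    exact: le_trans (rnorm_ge0 _) (c_rest n).
  have k0 : k = 0.
    by apply: rnorm_eq0; have := rest0 0%N; rewrite /rest /= linear0 subr0.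
  by exists 0; rewrite ?k0 ?linear0 // !rnorm0 !mulr0.
have [|l lP] := @cvg_halving _ _ s (fun n => c * rest n) c_rest.
  by move=> n; rewrite -mulrA ler_wpM2l.
have rest_geo n : rest n <= rest 0%N / 2 ^+ n.
  elim: n => [|n IH]; first by rewrite expr0 divr1.
  by rewrite exprSr invfM mulrA; have := restS n; lra.
exists l.
  have [M M0 XM] := bounded_rnorm X.
  apply/esym/eqP; rewrite -subr_eq0; apply/eqP/rnorm_eq0/eqP.
  rewrite eq_le rnorm_ge0 andbT; apply/ler_addgt0Pr => e e0; rewrite add0r.
  have [n ne] := geometric_small ((1 + M * (2 * c)) * rest 0%N) e0.
  apply: (le_trans (rnormB _ (X (s n)) _)).
  rewrite -linearB; apply: le_trans (ltW ne).
  have X1 := XM (s n - l); have X2 : M * rnorm (s n - l) <= M * (2 * (c * rest n)).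
    by rewrite ler_wpM2l// lP.
  apply: (@le_trans _ _ ((1 + M * (2 * c)) * rest n)).
    by rewrite /rest in X2 *; lra.
  by rewrite -mulrA ler_wpM2l// addr_ge0 ?mulr_ge0.
by have := lP 0%N; rewrite /rest /= sub0r rnormN linear0 subr0.
Qed.

(** By Baire, the image of some ball is dense in a ball centered at some [y];
    subtracting an approximation of [y] from one of [y + t k] approximates
    [t k], and after rescaling [k], up to half of its norm. *)
Lemma open_mapping (H K : hilbertType R) (X : {bounded H -> K}) :
  (forall k, exists h, X h = k) ->
  exists c, forall k, exists2 h, X h = k & rnorm h <= c * rnorm k.
Proof.
move=> Xsurj.
have [|N [y [r [r0 dense]]]] :=
    @baire_somewhere_dense _ _ (fun n => [set k | exists2 h, rnorm h <= n%:R & X h = k]).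
  move=> k; have [h hk] := Xsurj k; exists (Num.truncn (rnorm h)).+1, h => //.
  exact/ltW/truncnS_gt.
have {}dense z : rnorm (z - y) < r ->
    exists2 h, rnorm h <= N%:R & rnorm (X h - z) <= r / 8.
  move=> zy; have [|_ [h hN <-] hz] := dense z zy (r / 8); first by rewrite divr_gt0.
  by exists h => //; exact: ltW.
suff approx k : exists2 h, rnorm h <= (4 * N%:R / r) * rnorm k &
    rnorm (k - X h) <= rnorm k / 2.
  exists (2 * (4 * N%:R / r)) => k; have [h Xh hk] := approx_open_mapping approx k.
  by exists h => //; rewrite -[leRHS]mulrA.
have [->|k0] := eqVneq k 0.
  by exists 0; rewrite ?(linear0 X) ?subr0 !rnorm0 ?mulr0 ?mul0r.
have nk0 : 0 < rnorm k.
  by rewrite lt_neqAle rnorm_ge0 andbT eq_sym; apply: contra_neq k0 => /rnorm_eq0.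
(* The point [y + t k] lies at distance [r / 2] from [y], and the two errors
   [r / 8] add up to half of the norm of [t k]. *)
pose t := r / (2 * rnorm k).
have t0 : 0 < t by rewrite divr_gt0 ?mulr_gt0.
have [|h0 h0N Xh0] := dense y; first by rewrite subrr rnorm0.
have [|h1 h1N Xh1] := dense (y + t%:C%C *: k).
  rewrite addrC addKr rnormZ gtr0_norm// /t.
  have -> : r / (2 * rnorm k) * rnorm k = r / 2 by field; rewrite gt_eqF.
  lra.
have tV : (t^-1%:C * t%:C)%C = 1 by rewrite -rmorphM /= mulVf ?gt_eqF.
exists (t^-1%:C%C *: (h1 - h0)).
  rewrite rnormZ gtr0_norm ?invr_gt0// /t.
  have -> : 4 * N%:R / r * rnorm k = (r / (2 * rnorm k))^-1 * (N%:R + N%:R).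
    by field; rewrite !gt_eqF.
  rewrite ler_pM2l ?invr_gt0//; apply: (le_trans (rnormD _ _)).
  by rewrite rnormN lerD.
have -> : k - X (t^-1%:C%C *: (h1 - h0)) =
    t^-1%:C%C *: ((y + t%:C%C *: k - X h1) + (X h0 - y)).
  rewrite linearZ linearB /= -[in LHS](scale1r k) -tV -scalerA -scalerBr.
  congr (_ *: _).
  by rewrite [y + _]addrC [_ + y - _]addrAC addrACA subrr addr0 opprB addrCA addrC.
rewrite rnormZ gtr0_norm ?invr_gt0// /t.
have -> : rnorm k / 2 = (r / (2 * rnorm k))^-1 * (r / 8 + r / 8).
  by field; rewrite !gt_eqF.
rewrite ler_pM2l ?invr_gt0//; apply: (le_trans (rnormD _ _)).
by rewrite lerD// rnormBC.
Qed.

End operator_bounds.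

(** * Logarithmically convex sequences *)

Section real_sequences.
Variable R : realType.
Implicit Types a : nat -> R.

Lemma bounded_affine_le0 (u v M : R) : (forall n, u + n%:R * v <= M) -> v <= 0.
Proof.
move=> le_M; rewrite leNgt; apply/negP => v0.
have := le_M (Num.truncn ((M - u) / v)).+1; apply/negP; rewrite -ltNge.
by rewrite -ltrBlDl -ltr_pdivrMr// truncnS_gt.
Qed.

(** If [a 1 > a 0], then by convexity all the successive ratios are at least
    [1 + d := a 1 / a 0 > 1], and geometric growth contradicts linear growth. *)
Lemma log_convex_linear_growth_le01 a c :
  (forall n, 0 <= a n) -> (forall n, a n.+1 ^+ 2 <= a n * a n.+2) ->
  (forall n, a n <= c * n.+1%:R) -> a 1%N <= a 0%N.
Proof.
move=> a_ge0 a_cvx a_lin.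
have [a0|a0] := eqVneq (a 0%N) 0.
  by have := a_cvx 0%N; rewrite a0 mul0r exprn_even_le0//= => /eqP ->.
rewrite leNgt; apply/negP => a01.
have {}a0 : 0 < a 0%N by rewrite lt_neqAle eq_sym a0 a_ge0.
pose d := a 1%N / a 0%N - 1.
have d0 : 0 < d by rewrite subr_gt0 ltr_pdivlMr// mul1r.
have ratio n : 0 < a n /\ (1 + d) * a n <= a n.+1.
  elim: n => [|n [an IH]].
    by split=> //; rewrite addrC subrK divfK// gt_eqF.
  have aSn : 0 < a n.+1.
    by apply: lt_le_trans IH; rewrite mulr_gt0// addr_gt0.
  split=> //; rewrite -(ler_pM2l an); apply: le_trans (a_cvx n).
  by rewrite expr2 mulrCA mulrA ler_pM2r.
have d1 : 0 <= 1 + d by rewrite addr_ge0// ltW.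
have geo n : (1 + d) ^+ n * a 0%N <= a n.
  elim: n => [|n IH]; first by rewrite mul1r.
  apply: le_trans (proj2 (ratio n)); rewrite exprS -mulrA.
  by rewrite ler_wpM2l// addr_ge0// ltW.
have bernoulli n : n%:R * d <= (1 + d) ^+ n.
  suff : 1 + n%:R * d <= (1 + d) ^+ n by lra.
  elim: n => [|n IH]; first by rewrite mul0r addr0.
  rewrite exprS -natr1.
  have : (1 + d) * (1 + n%:R * d) <= (1 + d) * (1 + d) ^+ n.
    by rewrite ler_wpM2l// addr_ge0// ltW.
  have : 0 <= n%:R * d * d by rewrite !mulr_ge0// ltW.
  lra.
have c0 : 0 <= c by apply: le_trans (a_ge0 0%N) _; rewrite -[c]mulr1.
pose j := (Num.truncn (3 * c / (a 0%N * d ^+ 2))).+1.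
have jbig : 3 * c < j%:R * (a 0%N * d ^+ 2).
  by rewrite -ltr_pdivrMr ?truncnS_gt// mulr_gt0// exprn_gt0.
(* Bernoulli's inequality is linear in the exponent; applying it to the square
   of [(1 + d) ^+ j] yields a quadratic lower bound at the index [2 j]. *)
have : (j%:R * d) ^+ 2 * a 0%N <= c * (2 * j).+1%:R.
  apply: le_trans (a_lin (2 * j)%N); apply: le_trans (geo (2 * j)%N).
  rewrite ler_pM2r// mulnC exprM ler_pXn2r// nnegrE ?exprn_ge0//.
  by rewrite mulr_ge0// ltW.
rewrite leNgt => /negP; apply.
have j1 : 1 <= j%:R :> R by rewrite ler1n.
have : c * (2 * j).+1%:R <= 3 * c * j%:R.
  rewrite -natr1 natrM mulrAC [_ * c]mulrC ler_wpM2l//; lra.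
move=> /le_lt_trans; apply.
have -> : (j%:R * d) ^+ 2 * a 0%N = j%:R * (a 0%N * d ^+ 2) * j%:R by ring.
by rewrite ltr_pM2r// (lt_le_trans _ j1).
Qed.

(** The previous lemma applies from any index [n] on, since
    [n + k + 1 <= (n + 1) (k + 1)]. *)
Lemma log_convex_linear_growth_le0 a c :
  (forall n, 0 <= a n) -> (forall n, a n.+1 ^+ 2 <= a n * a n.+2) ->
  (forall n, a n <= c * n.+1%:R) -> forall n, a n <= a 0%N.
Proof.
move=> a_ge0 a_cvx a_lin; elim=> [//|n]; apply: le_trans.
have c0 : 0 <= c by apply: le_trans (a_ge0 0%N) _; rewrite -[c]mulr1.
have := @log_convex_linear_growth_le01 (fun k => a (n + k)%N) (c * n.+1%:R).
rewrite addn1 addn0; apply=> k //; first by rewrite !addnS.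
apply: le_trans (a_lin _) _; rewrite -mulrA ler_wpM2l// -natrM ler_nat.
by rewrite -addnS mulSnr leq_add2r leq_pmulr.
Qed.

End real_sequences.

(** * Operators similar to subnormal operators *)

Section hilbert_operators.
Variable R : realType.

(** Polarization over the complex scalars. *)
Lemma quadratic_form_eq0 (H : hilbertType R) (A : {linear H -> H}) :
  (forall h, '[A h, h] = 0) -> forall h, A h = 0.
Proof.
move=> A0 h; apply: rnorm_eq0; apply/eqP.
have polar u v : '[A u, v] + '[A v, u] = 0.
  have := A0 (u + v); rewrite linearD/= linearDl/= !linearDr/=.
  by rewrite !A0 addr0 add0r.
(* Multiplying the second vector by the imaginary unit changes the relative
   sign of the two terms of the polarized identity. *)
have := polar h ('i%C *: A h).
rewrite (linearZZ A) linearZl_LR/= linearZr_LR/=.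
have /eqP := polar h (A h); rewrite addrC addr_eq0 => /eqP ->.
rewrite inner_rnorm => /(congr1 (fun z : R[i] => complex.Im z)) /=.
rewrite !mul0r !mul1r ?add0r ?mulN1r.
move=> ?; rewrite -sqrf_eq0; apply/eqP; lra.
Qed.

(** With [g = N^n f], this is the Cauchy-Schwarz inequality for
    [|N g|^2 = <g, N' (N g)>], since [N] and its adjoint [N'] have the same norm
    at every vector. *)
Lemma normal_log_convex (H : hilbertType R) (N : {bounded H -> H}) (f : H) :
  normal_op N -> forall n, rnorm (iter n.+1 N f) ^+ 2 <=
    rnorm (iter n N f) * rnorm (iter n.+2 N f).
Proof.
move=> [N' [adj comm]] n; set g := iter n N f.
have N'N x : rnorm (N' x) = rnorm (N x).
  apply: (@pexpIrn _ 2) => //; rewrite ?nnegrE ?rnorm_ge0//.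
  apply: complexI; rewrite -!inner_rnorm -adj -[N (N' x)]/((N \o N') x) -comm /=.
  by rewrite inner_conj -adj -inner_conj.
rewrite /= -/g -(N'N (N g)).
have -> : rnorm (N g) ^+ 2 = complex.Re '[g, N' (N g)].
  by rewrite -adj inner_rnorm.
exact: Re_inner_le.
Qed.

(** [|X T^n h| = |N^n (V X h)|] is logarithmically convex, hence bounded by
    [|X h|], and the inverse of [X] is bounded. *)
Lemma similar_subnormal_bounded_orbit (H : hilbertType R) (T : {bounded H -> H}) :
  (exists (K : hilbertType R) (S : {bounded K -> K}),
     subnormal_op S /\ similar_op T S) ->
  forall h c, (forall n, rnorm (iter n T h) <= c * n.+1%:R) ->
  exists M, forall n, rnorm (iter n T h) <= M.
Proof.
move=> [K [S [[L [V [N [V_iso N_normal NV]]]] [X X_bij XT]]]] h c T_lin.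
have [M M0 XM] := bounded_rnorm X.
have [d Xd] : exists d, forall x, rnorm x <= d * rnorm (X x).
  case: X_bij => Y XK YK; have [|d dP] := @open_mapping _ _ _ X.
    by move=> k; exists (Y k).
  by exists d => x; have [y /(can_inj XK) ->] := dP (X x).
have XTn n : X (iter n T h) = iter n S (X h).
  by elim: n => //= n <-; exact: XT.
have VSn n : V (iter n S (X h)) = iter n N (V (X h)).
  by elim: n => //= n <-; rewrite -[RHS]/((N \o V) _) NV.
have V_rnorm k : rnorm (V k) = rnorm k by rewrite /rnorm V_iso.
pose a n := rnorm (iter n N (V (X h))).
have aE n : a n = rnorm (X (iter n T h)) by rewrite /a -VSn V_rnorm XTn.
have a_le : forall n, a n <= a 0%N.
  apply: (@log_convex_linear_growth_le0 _ a (M * c)) => n.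
  - exact: rnorm_ge0.
  - exact: normal_log_convex.
  - by rewrite aE (le_trans (XM _))// -mulrA ler_wpM2l.
exists (`|d| * a 0%N) => n; apply: (le_trans (Xd _)); rewrite -aE.
apply: (@le_trans _ _ (`|d| * a n)).
  by rewrite ler_wpM2r ?rnorm_ge0 ?ler_norm.
by rewrite ler_wpM2l.
Qed.

End hilbert_operators.

(** * Integrals with respect to a semispectral measure *)

Section semispectral_integrals.
Variables (R : realType) (H : hilbertType R) (F : semispectral H).
Implicit Types (h : H) (A U : set R).

Definition sm_mass h : R := complex.Re '[F (Rplus R) h, h].

Lemma sm_measure_Rplus h : sm_measure F h (Rplus R) = (sm_mass h)%:E.
Proof. by rewrite /sm_measure asboolT ?setIid//; exact: measurable_Rplus. Qed.

Lemma inner_F_Rplus h : '[F (Rplus R) h, h] = (sm_mass h)%:C%C.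
Proof.
have := @sm_ge0 _ _ F _ (@measurable_Rplus R) (@subset_refl _ _) h.
rewrite linear0l => F0; rewrite /sm_mass RRe_real//.
exact: ger0_real.
Qed.

Lemma sm_mass_ge0 h : 0 <= sm_mass h.
Proof.
have := @sm_ge0 _ _ F _ (@measurable_Rplus R) (@subset_refl _ _) h.
by rewrite linear0l inner_F_Rplus ler0c.
Qed.

Lemma sm_integrable_cst h (c : R) :
  (sm_measure F h).-integrable (Rplus R) (EFin \o cst c).
Proof.
have mRp := @measurable_Rplus R.
apply/integrableP; split; first by apply/measurable_EFinP; exact: measurable_cst.
rewrite -[X in integral _ _ X]/(cst `|c|%:E) integral_cst//=.
by rewrite [X in (_ * X)%E]sm_measure_Rplus -EFinM ltry.
Qed.

Lemma Rintegral_sm_cst h (c : R) :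
  \int[sm_measure F h]_(x in Rplus R) cst c x = c * sm_mass h.
Proof.
rewrite Rintegral_cst/= ?[X in fine X]sm_measure_Rplus//.
exact: measurable_Rplus.
Qed.

(** The real line has a countable base: the intervals with rational endpoints
    that are null cover [U]. *)
Lemma locally_negligible h U :
  (forall x, U x -> exists2 V, open V /\ V x & sm_measure F h V = 0%E) ->
  (sm_measure F h).-negligible U.
Proof.
move=> Uloc.
pose I (p : rat * rat) : set R := `]ratr p.1, ratr p.2[%classic.
pose D n : set R := if unpickle n is Some p then
  if `[< sm_measure F h (I p) = 0%E >] then I p else set0 else set0.
apply: (@negligibleS _ _ _ _ (\bigcup_n D n)); last first.
  apply: negligible_bigcup => n; rewrite /D.
  case: unpickle => [p|]; last exact: negligible_set0.
  case: asboolP => [p0|_]; last exact: negligible_set0.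
  by exists (I p); split => //; exact: measurable_itv.
move=> x /Uloc [V [Vo Vx] V0].
have /nbhs_ballP[e /= e0 xeV] : nbhs x V by apply: open_nbhs_nbhs.
have [|q1 q1P] := @rat_in_itvoo _ (x - e) x; first lra.
have [|q2 q2P] := @rat_in_itvoo _ x (x + e); first lra.
move: q1P q2P; rewrite !in_itv/= => /andP[q11 q12] /andP[q21 q22].
exists (pickle (q1, q2)); [exact: Logic.I|rewrite /D pickleK asboolT].
  by rewrite /I /= in_itv /= q12.
apply/eqP; rewrite eq_le measure_ge0 andbT -V0.
apply: le_measure; rewrite ?inE; [exact: measurable_itv|exact: open_measurable|].
move=> y; rewrite /I /= in_itv/= => /andP[y1 y2]; apply: xeV.
rewrite /ball/= ltr_distlC; lra.
Qed.

Lemma supp_complement_negligible h A :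
  closed A -> sm_supp F `<=` A -> (sm_measure F h).-negligible (~` A).
Proof.
move=> Ac suppA; apply: locally_negligible => x nAx.
(* The measure lives on the whole line but is null on the negative numbers. *)
have [x0|x0] := ltP x 0.
  exists `]-oo, 0[%classic; first by split; [exact: interval_open|rewrite /= in_itv].
  rewrite /sm_measure asboolT; last exact: measurable_itv.
  rewrite (_ : _ `&` _ = set0) ?sm_set0//.
  rewrite -subset0 => y [] /=; rewrite /Rplus /= !in_itv/= andbT => y0.
  by rewrite leNgt y0.
have Rx : Rplus R x by rewrite /Rplus /= in_itv /= x0.
have : ~ sm_supp F x by move=> /suppA.
move=> /not_andP[//|] /existsNP[U] /not_implyP[Uo] /not_implyP[Ux /contrapT U0].
exists U; first by [].
rewrite /sm_measure asboolT; last exact: open_measurable.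
by rewrite U0 linear0l.
Qed.

(** A closed set that contains the support carries the measure, so bounding the
    integrand there is enough. *)
Lemma integral_le_supp h A (f : R -> R) (c : R) : closed A -> sm_supp F `<=` A ->
  0 <= c ->
  (sm_measure F h).-integrable (Rplus R) (EFin \o f) ->
  (forall x, Rplus R x -> A x -> f x <= c) ->
  \int[sm_measure F h]_(x in Rplus R) f x <= c * sm_mass h.
Proof.
move=> Ac suppA c0 fint fc.
have mA : measurable (~` A) by apply: measurableC; exact: closed_measurable.
have /negligibleP A0 := supp_complement_negligible h Ac suppA.
have mRp := @measurable_Rplus R.
have offA g : (sm_measure F h).-integrable (Rplus R) (EFin \o g) ->
    \int[sm_measure F h]_(x in Rplus R) g x =
    \int[sm_measure F h]_(x in Rplus R `\` ~` A) g x.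
  by move=> gint; rewrite /Rintegral (@negligible_integral _ _ _ _ _ (~` A)) ?A0.
have cint := @sm_integrable_cst h c.
rewrite -Rintegral_sm_cst.
rewrite !offA//; apply: le_Rintegral.
- exact: measurableD.
- by apply: integrableS fint => //; exact: measurableD.
- by apply: integrableS cint => //; exact: measurableD.
- by move=> x [Rx /contrapT Ax]; exact: fc.
Qed.

End semispectral_integrals.

(** * The polynomials [Qpoly] *)

Section Qpoly.
Variable R : realType.

Lemma Qpoly_ge0 n (x : R) : Rplus R x -> 0 <= Qpoly n x.
Proof.
rewrite /Rplus /= in_itv/= andbT => x0.
by apply: sumr_ge0 => j _; rewrite mulr_ge0 ?exprn_ge0.
Qed.

(** Induction on [n] by this recurrence replaces any closed form of [Qpoly]. *)
Lemma QpolyS n (x : R) : Qpoly n.+1 x = Qpoly n x + \sum_(0 <= j < n) x ^+ j.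
Proof.
(* The term of index [n - 1] has a zero coefficient. *)
have -> : Qpoly n x = \sum_(0 <= j < n) (n - j - 1)%N%:R * x ^+ j.
  case: n => [|n]; rewrite /Qpoly /= ?big_nil// [RHS]big_nat_recr//=.
  by rewrite subSnn mul0r addr0.
rewrite /Qpoly /= -big_split /=; apply: eq_big_nat => j /andP[_ jn].
rewrite -[X in _ + X]mul1r -mulrDl natr1; congr (_%:R * _); lia.
Qed.

Lemma Qpoly_le_sqr n (x : R) : 0 <= x <= 1 -> Qpoly n x <= n%:R ^+ 2.
Proof.
move=> /andP[x0 x1]; elim: n => [|n IH].
  by rewrite /Qpoly big_nil expr0n.
have : \sum_(0 <= j < n) x ^+ j <= n%:R.
  rewrite -[X in _ <= X%:R]subn0 -sumr_const_nat; apply: ler_sum => j _.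
  exact: exprn_ile1.
rewrite QpolyS -natr1; have : 0 <= n%:R :> R by [].
lra.
Qed.

Lemma Qpoly0_le n : Qpoly n (0 : R) <= n%:R.
Proof.
elim: n => [|n IH]; first by rewrite /Qpoly big_nil.
rewrite QpolyS -natr1 lerD//; case: n {IH} => [|n]; first by rewrite big_nil.
rewrite big_nat_recl// big1 ?addr0// => j _.
by rewrite exprS mul0r.
Qed.

(** The index starts at 1, as [Qpoly 0 = Qpoly 1 = 0]. *)
Lemma QpolyS_ge n (x : R) : Rplus R x -> Qpoly n.+1 x + 1 <= Qpoly n.+2 x.
Proof.
rewrite /Rplus /= in_itv/= andbT => x0.
rewrite (QpolyS n.+1) lerD2l big_nat_recl// expr0 lerDl.
by apply: sumr_ge0 => j _; exact: exprn_ge0.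
Qed.

End Qpoly.

(** * Consequences of the bounded orbits for the representing triplet *)

Lemma Re_mul_nat (R : realType) n (z : R[i]) :
  complex.Re (n%:R * z) = n%:R * complex.Re z.
Proof. by rewrite !mulr_natl raddfMn. Qed.

Section representing_triplets.
Variables (R : realType) (H : hilbertType R).
Variables (T B C : {bounded H -> H}) (F : semispectral H).
Implicit Type h : H.

Local Notation form A h := (complex.Re '[A h, h]).
Local Notation "\intQ( n , h )" :=
  (\int[sm_measure F h]_(x in Rplus R) Qpoly n x) (at level 0).

Lemma self_adjoint_inner_real (A : {bounded H -> H}) h :
  self_adjoint A -> '[A h, h] = (form A h)%:C%C.
Proof.
move=> sA; have : '[A h, h] = ('[A h, h])^* by rewrite -inner_conj sA.
case: '[A h, h] => a b /(congr1 (fun z : R[i] => complex.Im z)) /= bN.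
congr (_ +i* _)%C; lra.
Qed.

Lemma iter_adjoint (T' : {bounded H -> H}) n x y :
  adjoint_of T T' -> '[iter n T' x, y] = '[x, iter n T y].
Proof.
move=> adj; elim: n x y => //= n IH x y.
by rewrite inner_conj -adj -inner_conj IH -iterSr.
Qed.

Hypothesis triplet : representing_triplet T B C F.

(** The operator identity of the representing triplet, tested against [h]. *)
Lemma orbit_sqr_norm h n :
  (sm_measure F h).-integrable (Rplus R) (EFin \o Qpoly n) /\
  rnorm (iter n T h) ^+ 2 =
    rnorm h ^+ 2 + n%:R * form B h + n%:R ^+ 2 * form C h + \intQ(n, h).
Proof.
have [_ _ _ _ [T' adj /(_ n) [J /(_ h) [Qint JE] TnE]]] := triplet.
split=> //; set r := RHS; have := congr1 (fun z => complex.Re '[z, h]) (TnE h).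
rewrite iter_adjoint// !linearDl/= !linearZl_LR/= !raddfD/= !inner_rnorm JE /=.
by rewrite !Re_mul_nat natrX => ->.
Qed.

(** [Qpoly n <= n^2] on [[0,1]], so every term of the formula for
    [|T^n h|^2] is at most a constant times [(n + 1)^2]. *)
Lemma orbit_linear_growth h : sm_supp F `<=` `[0, 1] ->
  exists c, forall n, rnorm (iter n T h) <= c * n.+1%:R.
Proof.
move=> supp01.
pose M := rnorm h ^+ 2 + `|form B h| + `|form C h| + sm_mass F h.
have m_ge0 := sm_mass_ge0 F h.
exists (1 + M) => n.
have M0 : 0 <= M by rewrite /M !addr_ge0 ?sqr_ge0.
have M1 : 0 <= 1 + M by rewrite addr_ge0.
rewrite -(@ler_pXn2r _ 2) ?nnegrE ?rnorm_ge0 ?(mulr_ge0 M1)//.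
have [Qint ->] := orbit_sqr_norm h n.
have Q_le : \intQ(n, h) <= n%:R ^+ 2 * sm_mass F h.
  apply: (integral_le_supp _ supp01) => //; first exact: interval_closed.
  by move=> x _ /=; rewrite in_itv /= => x01; exact: Qpoly_le_sqr.
have b_le := ler_norm (form B h); have c_le := ler_norm (form C h).
have N1 : 1 <= n.+1%:R ^+ 2 :> R by rewrite -natrX ler1n.
have nN : n%:R <= n.+1%:R ^+ 2 :> R.
  by rewrite -natrX ler_nat (leq_trans (leqnSn n))// leq_pmulr.
have n2N : n%:R ^+ 2 <= n.+1%:R ^+ 2 :> R by rewrite -!natrX ler_nat leq_sqr.
set N := n.+1%:R ^+ 2 in N1 nN n2N *.
apply: (@le_trans _ _ (M * N)).
  rewrite /M !mulrDl !lerD ?ler_peMr ?sqr_ge0//.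
  - by apply: le_trans (ler_wpM2l _ b_le) _ => //; rewrite mulrC ler_wpM2l.
  - by apply: le_trans (ler_wpM2l _ c_le) _; rewrite ?exprn_ge0// mulrC ler_wpM2l.
  - by apply: le_trans Q_le _; rewrite mulrC ler_wpM2l.
rewrite exprMn ler_wpM2r ?exprn_ge0//.
have : 0 <= M ^+ 2 := sqr_ge0 M.
by move: M0; generalize M => m; nra.
Qed.

Hypothesis bounded_orbits :
  forall h, exists M, forall n, rnorm (iter n T h) <= M.

Lemma bounded_orbit_sqr h : exists M, forall n, rnorm (iter n T h) ^+ 2 <= M.
Proof.
have [M TM] := bounded_orbits h; exists (M ^+ 2) => n.
by rewrite ler_pXn2r ?nnegrE ?rnorm_ge0// (le_trans (rnorm_ge0 _) (TM n)).
Qed.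

(** [n <Bh,h> + n^2 <Ch,h>] is bounded above, the rest of the formula being
    nonnegative; divided by [n], this bounds [<Bh,h> + n <Ch,h>]. *)
Lemma C_eq0 : C =1 \0.
Proof.
have [_ C_ge0 _ _ _] := triplet.
suff C0 h : '[C h, h] = 0 by exact: quadratic_form_eq0.
have := C_ge0 h; rewrite linear0l lecE /= => /andP[/eqP ImC ReC].
suff : form C h <= 0.
  move=> ReC'; apply/eqP; rewrite eq_complex ImC eqxx andbT /=.
  by rewrite eq_le ReC ReC'.
have [M TM] := bounded_orbit_sqr h.
(* The bound [`|form B h|] serves the index 0, where one cannot divide. *)
apply: (@bounded_affine_le0 R (form B h) _ (Num.max M `|form B h|)) => -[|n].
  by rewrite mul0r addr0 le_max ler_norm orbT.
rewrite le_max; apply/orP; left.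
have n0 : 0 < n.+1%:R :> R by [].
rewrite -(ler_pM2l n0); have M0 : 0 <= M by apply: le_trans (TM 0%N); exact: sqr_ge0.
apply: (@le_trans _ _ M); last by rewrite ler_peMl// ler1n.
apply: le_trans (TM n.+1); have [_ ->] := orbit_sqr_norm h n.+1.
have : 0 <= \intQ(n.+1, h) by apply: Rintegral_ge0 => x; exact: Qpoly_ge0.
have := sqr_ge0 (rnorm h); lra.
Qed.

(** The integral of [Qpoly n.+1] is at least [n * F_h(R_+)], so that
    [n (<Bh,h> + F_h(R_+))] is bounded above. *)
Lemma B_plus_mass_le0 h : form B h + sm_mass F h <= 0.
Proof.
have [M TM] := bounded_orbit_sqr h.
apply: (@bounded_affine_le0 R (rnorm h ^+ 2 + form B h) _ M) => n.
apply: le_trans (TM n.+1).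
have [Qint ->] := orbit_sqr_norm h n.+1.
rewrite C_eq0 linear0l mulr0 addr0.
suff : n%:R * sm_mass F h <= \intQ(n.+1, h) by rewrite -natr1; lra.
elim: n => [|n IH] in Qint *.
  rewrite mul0r; apply: Rintegral_ge0 => x; exact: Qpoly_ge0.
have [Qint' _] := orbit_sqr_norm h n.+1.
rewrite -natr1 mulrDl mul1r.
apply: le_trans (lerD (IH Qint') (lexx _)) _.
have mRp := @measurable_Rplus R.
have cint := @sm_integrable_cst _ _ F h 1.
rewrite -[X in _ + X]mul1r -Rintegral_sm_cst.
rewrite -RintegralD//; apply: le_Rintegral => //.
  exact: (integrableD mRp Qint' cint).
by move=> x; exact: QpolyS_ge.
Qed.

(** Here the integral of [Qpoly n] is at most [n * F_h(R_+)], so that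
    [- n (<Bh,h> + F_h(R_+))] is bounded above by [|h|^2]. *)
Lemma B_plus_mass_ge0 h : sm_supp F `<=` [set 0] -> 0 <= form B h + sm_mass F h.
Proof.
move=> supp0; rewrite -oppr_le0.
apply: (@bounded_affine_le0 R 0 _ (rnorm h ^+ 2)) => n.
have [Qint] := orbit_sqr_norm h n.
rewrite C_eq0 linear0l mulr0 addr0.
have := sqr_ge0 (rnorm (iter n T h)).
have : \intQ(n, h) <= n%:R * sm_mass F h.
  apply: (integral_le_supp _ supp0) => //.
  by move=> x _ ->; exact: Qpoly0_le.
lra.
Qed.

End representing_triplets.

Theorem theorem2p1p3 (R : realType) (H : hilbertType R)
    (T B C : {bounded H -> H}) (F : semispectral H) :
  cond_pos_def T ->
  representing_triplet T B C F ->
  sm_supp F `<=` `[0, 1] ->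
  (exists (K : hilbertType R) (S : {bounded K -> K}),
     subnormal_op S /\ similar_op T S) ->
  [/\ C =1 \0,
      op_le (B \+ F (Rplus R)) \0,
      B \+ F (Rplus R) =1 \0 \/ ~ sm_supp F `<=` [set 0] &
      ~ op_le \0 B \/ sm_supp F `&` `]0, 1[ = set0].
Proof.
move=> _ triplet supp01 sim.
have bounded h : exists M, forall n, rnorm (iter n T h) <= M.
  have [c T_lin] := orbit_linear_growth triplet h supp01.
  exact: similar_subnormal_bounded_orbit T_lin.
have [B_sa _ _ _ _] := triplet.
have BF h : '[(B \+ F (Rplus R)) h, h] = (complex.Re '[B h, h] + sm_mass F h)%:C%C.
  rewrite /= linearDl /= inner_F_Rplus (self_adjoint_inner_real _ B_sa).
  by rewrite -rmorphD.
have BF_le0 := B_plus_mass_le0 triplet bounded.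
split.
- exact: C_eq0 triplet bounded.
- by move=> h; rewrite linear0l BF lecR.
- have [supp0|nsupp0] := pselect (sm_supp F `<=` [set 0]); [left|by right].
  apply: quadratic_form_eq0 => h; rewrite BF; congr (_%:C%C).
  apply/eqP; rewrite eq_le BF_le0 /=.
  exact: B_plus_mass_ge0 triplet bounded _ supp0.
- have [B_ge0|nB] := pselect (op_le \0 B); [right|by left].
  rewrite -subset0 => x [[_ suppx] _]; apply: (suppx setT openT Logic.I).
  rewrite setTI; apply: quadratic_form_eq0 => h.
  rewrite inner_F_Rplus; congr (_%:C%C); apply/eqP.
  rewrite eq_le sm_mass_ge0 andbT.
  have := B_ge0 h; rewrite linear0l (self_adjoint_inner_real _ B_sa) ler0c.
  by have := BF_le0 h; lra.
Qed.
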